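(* Let $Q$ be a divisible unital quantale with associated quantaloid $\mathcal{Q}$. There is a functor $\mathcal{M}:\mathcal{Q}\text{-}\mathbf{Ctx}\to\mathcal{Q}\text{-}\mathbf{CCat}$ that sends each fuzzy context $(\mathsf{A},\mathsf{B},\phi)$ to its formal concept lattice $\mathcal{M}_{\phi}(\mathsf{A},\mathsf{B})$. This functor is obtained by restricting to $\mathcal{Q}\text{-}\mathbf{Ctx}$ the domain of the functor $\mathcal{M}:\mathcal{Q}\text{-}\mathbf{Info}\to\mathcal{Q}\text{-}\mathbf{CCat}$, which sends $\phi:\mathbb{A}\rightsquigarrow\mathbb{B}$ to $\mathcal{M}(\phi)=\phi^{\downarrow}\circ\phi_{\uparrow}(\mathcal{P}\mathbb{A})$ and an infomorphism $(F,G):\phi\to\psi$ to $\psi^{\downarrow}\circ\psi_{\uparrow}\circ F^{\rightarrow}:\mathcal{M}(\phi)\to\mathcal{M}(\psi)$, and identifying $\mathcal{M}_{\phi}(\mathsf{A},\mathsf{B})$ with $\mathcal{M}(\phi)$ via $(\mu,\lambda)\mapsto\mu$.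
   Context: A unital quantale is a complete lattice $Q$ with a monoid operation $\&$ (unit $I$) preserving arbitrary joins in each variable; $a\backslash b$ and $b/a$ are determined by $c\le a\backslash b\iff a\& c\le b$ and $c\le b/a\iff c\& a\le b$. It is divisible if $a\le b$ implies $x\& b=a=b\& y$ for some $x,y\in Q$; then $I$ is the top element. A divisible unital quantale $Q$ induces a small quantaloid $\mathcal{Q}$ (a category whose hom-sets are complete lattices with composition preserving joins in each variable): objects are the elements of $Q$; $\mathcal{Q}(X,Y)=\{\alpha\in Q:\alpha\le X\wedge Y\}$ with order from $Q$; composition of $\alpha\in\mathcal{Q}(X,Y)$ and $\beta\in\mathcal{Q}(Y,Z)$ is $\beta\circ\alpha=\beta\&(Y\backslash\alpha)=(\beta/Y)\&\alpha$; the identity on $X$ is $X$. In a quantaloid, for $f:X\to Y$, $g:Y\to Z$, $h:X\to Z$, $h\swarrow f:Y\to Z$ is the largest arrow with $(h\swarrow f)\circ f\le h$, and $g\searrow h:X\to Y$ is the largest arrow with $g\circ(g\searrow h)\le h$. A $\mathcal{Q}$-category $\mathbb{A}$ is a set $\mathbb{A}_0$ with a type map $t$ to the objects of $\mathcal{Q}$ and hom-arrows $\mathbb{A}(x,y)\in\mathcal{Q}(tx,ty)$ with $1_{tx}\le\mathbb{A}(x,x)$ and $\mathbb{A}(y,z)\circ\mathbb{A}(x,y)\le\mathbb{A}(x,z)$. A $\mathcal{Q}$-functor is a type-preserving map with $\mathbb{A}(x,x')\le\mathbb{B}(Fx,Fx')$. The underlying preorder is $x\le y$ iff $tx=ty$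 and $1_{tx}\le\mathbb{A}(x,y)$; $\mathbb{A}$ is skeletal if it is antisymmetric; $\mathcal{Q}$-functors are ordered pointwise, and $F$ is left adjoint to $G$ if $1\le G\circ F$, $F\circ G\le 1$. A $\mathcal{Q}$-distributor $\phi:\mathbb{A}\rightsquigarrow\mathbb{B}$ assigns to $(x,y)\in\mathbb{A}_0\times\mathbb{B}_0$ an arrow $\phi(x,y)\in\mathcal{Q}(tx,ty)$ with $\mathbb{B}(y',y)\circ\phi(x,y')\le\phi(x,y)$ and $\phi(x',y)\circ\mathbb{A}(x,x')\le\phi(x,y)$; distributors form a quantaloid with pointwise order, composition $(\psi\circ\phi)(x,z)=\bigvee_y\psi(y,z)\circ\phi(x,y)$, and implications $(\eta\swarrow\phi)(y,z)=\bigwedge_x\eta(x,z)\swarrow\phi(x,y)$, $(\psi\searrow\eta)(x,y)=\bigwedge_z\psi(y,z)\searrow\eta(x,z)$. $*_X$ is the $\mathcal{Q}$-category with one object of type $X$ and hom-arrow $1_X$. $\mathcal{P}\mathbb{A}$ has as objects of type $X$ the distributors $\mu:\mathbb{A}\rightsquigarrow *_X$, with $\mathcal{P}\mathbb{A}(\mu,\lambda)=\lambda\swarrow\mu$. $\mathcal{P}^{\dagger}\mathbb{A}$ has as objects of type $X$ the distributors $\mu:*_X\rightsquigarrow\mathbb{A}$, with $\mathcal{P}^{\dagger}\mathbb{A}(\mu,\lambda)=\lambda\searrow\mu$. For $\phi:\mathbb{A}\rightsquigarrow\mathbb{B}$: $\phi_{\uparrow}:\mathcal{P}\mathbb{A}\to\mathcal{P}^{\dagger}\mathbb{B}$,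 $\phi_{\uparrow}(\mu)=\phi\swarrow\mu$, and $\phi^{\downarrow}:\mathcal{P}^{\dagger}\mathbb{B}\to\mathcal{P}\mathbb{A}$, $\phi^{\downarrow}(\lambda)=\lambda\searrow\phi$; $\phi^{\downarrow}\circ\phi_{\uparrow}(\mathcal{P}\mathbb{A})$ is the full $\mathcal{Q}$-subcategory of fixed points of $\phi^{\downarrow}\circ\phi_{\uparrow}$. For $F:\mathbb{A}\to\mathbb{B}$, $F^{\rightarrow}(\mu)=\mu\circ F^{\natural}$ with $F^{\natural}(y,x)=\mathbb{B}(y,Fx)$. $\mathbb{A}$ is complete if for every $\mu\in\mathcal{P}\mathbb{A}$ there is $a\in\mathbb{A}_0$ with $\mathbb{A}(a,-)=\mathbb{A}\swarrow\mu$ (equivalently, it has all weighted limits). $\mathcal{Q}\text{-}\mathbf{CCat}$ is the category of skeletal complete $\mathcal{Q}$-categories (separated complete $Q$-preordered $Q$-subsets) and left adjoint $\mathcal{Q}$-functors. $\mathcal{Q}\text{-}\mathbf{Info}$ has $\mathcal{Q}$-distributors as objects; a morphism (infomorphism) $(F,G)$ from $\phi:\mathbb{A}\rightsquigarrow\mathbb{B}$ to $\psi:\mathbb{A}'\rightsquigarrow\mathbb{B}'$ is a pair of $\mathcal{Q}$-functors $F:\mathbb{A}\to\mathbb{A}'$, $G:\mathbb{B}'\to\mathbb{B}$ with $\phi(x,Gy')=\psi(Fx,y')$ for all $x,y'$. A $Q$-subset $\mathsf{A}$ is a set $\mathsf{A}_0$ with a map $\mathsf{A}:\mathsf{A}_0\to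 Q$; it is regarded as a discrete $\mathcal{Q}$-category with $tx=\mathsf{A}x$, $\mathsf{A}(x,x)=\mathsf{A}x$ and $\mathsf{A}(x,y)=0$ for $x\ne y$. A fuzzy context is a triple $(\mathsf{A},\mathsf{B},\phi)$ of $Q$-subsets $\mathsf{A},\mathsf{B}$ and a distributor $\phi:\mathsf{A}\rightsquigarrow\mathsf{B}$ (i.e. a map $\phi:\mathsf{A}_0\times\mathsf{B}_0\to Q$ with $\phi(x,y)\le\mathsf{A}x\wedge\mathsf{B}y$). $\mathcal{Q}\text{-}\mathbf{Ctx}$ is the full subcategory of $\mathcal{Q}\text{-}\mathbf{Info}$ on fuzzy contexts. The formal concept lattice $\mathcal{M}_{\phi}(\mathsf{A},\mathsf{B})$ has as objects the pairs $(\mu,\lambda)\in(\mathcal{P}\mathsf{A})_0\times(\mathcal{P}^{\dagger}\mathsf{B})_0$ with $\lambda=\phi_{\uparrow}(\mu)$ and $\mu=\phi^{\downarrow}(\lambda)$, of type $t\mu=t\lambda$, with hom from $(\mu,\lambda)$ to $(\mu',\lambda')$ equal to $\mathcal{P}\mathsf{A}(\mu,\mu')=\mathcal{P}^{\dagger}\mathsf{B}(\lambda,\lambda')$. *)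

(* Defs.v *)
From HB Require Import structures.
From mathcomp Require Import all_boot all_order.
From mathcomp Require Import boolp classical_sets.

Set Implicit Arguments.
Unset Strict Implicit.
Unset Printing Implicit Defensive.

Set Warnings "-projection-no-head-constant,-redundant-canonical-projection".

Import Order.TTheory.
Local Open Scope classical_set_scope.
Local Open Scope order_scope.

HB.mixin Record TBLattice_isComplete d T of Order.TBLattice d T := {
  bigjoin : set T -> T;
  bigjoinP : forall S : set T, supremums S (bigjoin S)
}.

#[short(type="completeLatticeType")]
HB.structure Definition CompleteLattice d :=
  {T of TBLattice_isComplete d T & Order.TBLattice d T}.

Definition bigmeet d (T : completeLatticeType d) (S : set T) : T :=
  bigjoin (lbound S).

HB.factory Record POrder_isComplete d T of Order.POrder d T := {
  bigjoin : set T -> T;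
  bigjoinP : forall S : set T, supremums S (bigjoin S)
}.

HB.builders Context d T of POrder_isComplete d T.

Let binf (x y : T) := bigjoin [set z | z <= x /\ z <= y].
Let bsup (x y : T) := bigjoin [set z | z = x \/ z = y].

Let binfP x y z : (x <= binf y z) = (x <= y) && (x <= z).
Proof.
have [ub lub] := bigjoinP [set t | t <= y /\ t <= z].
apply/idP/andP => [le_x|[xy xz]]; last exact: ub.
by split; apply: le_trans le_x _; apply: lub => t [].
Qed.

Let bsupP x y z : (bsup x y <= z) = (x <= z) && (y <= z).
Proof.
have [ub lub] := bigjoinP [set t | t = x \/ t = y].
apply/idP/andP => [le_z|[xz yz]]; last by apply: lub => t [->|->].
by split; apply: le_trans le_z; apply: ub; [left|right].
Qed.

Let bbot_le (x : T) : bigjoin set0 <= x.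
Proof. by have [_ lub] := bigjoinP set0; apply: lub => t []. Qed.

Let btop_ge (x : T) : x <= bigjoin setT.
Proof. by have [ub _] := bigjoinP setT; apply: ub. Qed.

HB.instance Definition _ := Order.POrder_isMeetSemilattice.Build d T binfP.
HB.instance Definition _ := Order.POrder_isJoinSemilattice.Build d T bsupP.
HB.instance Definition _ := Order.hasBottom.Build d T bbot_le.
HB.instance Definition _ := Order.hasTop.Build d T btop_ge.
HB.instance Definition _ := TBLattice_isComplete.Build d T bigjoinP.

HB.end.

HB.mixin Record isUnitalQuantale d Q of CompleteLattice d Q & Monoid Q := {
  mulq_joinr : forall (a : Q) (S : set Q),
    (a * bigjoin S)%g = bigjoin [set (a * x)%g | x in S];
  mulq_joinl : forall (a : Q) (S : set Q),
    (bigjoin S * a)%g = bigjoin [set (x * a)%g | x in S]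
}.

#[short(type="unitalQuantaleType")]
HB.structure Definition UnitalQuantale d :=
  {Q of isUnitalQuantale d Q & CompleteLattice d Q & Monoid Q}.

HB.mixin Record isDivisible d Q of UnitalQuantale d Q := {
  divisibleP : forall a b : Q, a <= b ->
    exists x y : Q, (x * b)%g = a /\ a = (b * y)%g
}.

#[short(type="divQuantaleType")]
HB.structure Definition DivQuantale d :=
  {Q of isDivisible d Q & UnitalQuantale d Q}.

Section CompleteLatticeTheory.
Context {d : Order.disp_t} {T : completeLatticeType d}.
Implicit Types (S : set T) (x : T).

Lemma bigjoin_ub S x : S x -> x <= bigjoin S.
Proof. by have [ub _] := bigjoinP S; apply: ub. Qed.

Lemma bigjoin_le S x : (forall y, S y -> y <= x) -> bigjoin S <= x.
Proof. by have [_ lub] := bigjoinP S; apply: lub. Qed.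

Lemma bigmeet_lb S x : S x -> bigmeet S <= x.
Proof. by move=> Sx; apply: bigjoin_le => y; apply. Qed.

Lemma bigmeet_ge S x : (forall y, S y -> x <= y) -> x <= bigmeet S.
Proof. exact: bigjoin_ub. Qed.

End CompleteLatticeTheory.

Section Residuals.
Context {d : Order.disp_t} {Q : unitalQuantaleType d}.
Implicit Types a b c x y : Q.

(* a \ b *)
Definition lres a b : Q := bigjoin [set c | (a * c)%g <= b].
(* b / a *)
Definition rres b a : Q := bigjoin [set c | (c * a)%g <= b].

Lemma mulq_le2l a x y : x <= y -> (a * x <= a * y)%g.
Proof.
move=> xy; have -> : y = bigjoin [set z | z = x \/ z = y].
  apply/eqP; rewrite eq_le; apply/andP; split; first by apply: bigjoin_ub; right.
  by apply: bigjoin_le => z [->|->].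
by rewrite mulq_joinr; apply: bigjoin_ub; exists x => //; left.
Qed.

Lemma mulq_le2r a x y : x <= y -> (x * a <= y * a)%g.
Proof.
move=> xy; have -> : y = bigjoin [set z | z = x \/ z = y].
  apply/eqP; rewrite eq_le; apply/andP; split; first by apply: bigjoin_ub; right.
  by apply: bigjoin_le => z [->|->].
by rewrite mulq_joinl; apply: bigjoin_ub; exists x => //; left.
Qed.

Lemma lresP a b c : (c <= lres a b) = ((a * c)%g <= b).
Proof.
apply/idP/idP => [cab|]; last exact: bigjoin_ub.
apply: le_trans (mulq_le2l a cab) _; rewrite mulq_joinr.
by apply: bigjoin_le => _ [x] /= ? <-.
Qed.

Lemma rresP a b c : (c <= rres b a) = ((c * a)%g <= b).
Proof.
apply/idP/idP => [cab|]; last exact: bigjoin_ub.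
apply: le_trans (mulq_le2r a cab) _; rewrite mulq_joinl.
by apply: bigjoin_le => _ [x] /= ? <-.
Qed.

End Residuals.

Section Arrows.
Context {d : Order.disp_t} {Q : unitalQuantaleType d}.

Record arrow (X Y : Q) := Arrow {
  aval : Q;
  aval_le : aval <= X `&` Y
}.

HB.instance Definition _ (X Y : Q) := [isSub for @aval X Y].
HB.instance Definition _ (X Y : Q) := [Choice of arrow X Y by <:].
HB.instance Definition _ (X Y : Q) :=
  [SubChoice_isSubPOrder of arrow X Y by <: with d].

Fact arrow_bigjoin_le (X Y : Q) (S : set (arrow X Y)) :
  bigjoin (@aval X Y @` S) <= X `&` Y.
Proof. by apply: bigjoin_le => _ [a _ <-]; exact: aval_le. Qed.

Definition arrow_bigjoin (X Y : Q) (S : set (arrow X Y)) : arrow X Y :=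
  Arrow (arrow_bigjoin_le S).

Fact arrow_bigjoinP (X Y : Q) (S : set (arrow X Y)) :
  supremums S (arrow_bigjoin S).
Proof.
split=> [a Sa|b ub]; first by apply: bigjoin_ub; exists a.
by apply: bigjoin_le => _ [a Sa <-]; exact: (ub a Sa).
Qed.

HB.instance Definition _ (X Y : Q) :=
  POrder_isComplete.Build d (arrow X Y) (@arrow_bigjoinP X Y).

Lemma leaE (X Y : Q) (f g : arrow X Y) : (f <= g) = (aval f <= aval g).
Proof. by []. Qed.

Lemma aval_inj (X Y : Q) : injective (@aval X Y).
Proof. exact: val_inj. Qed.

Lemma aval_bigjoin (X Y : Q) (S : set (arrow X Y)) :
  aval (bigjoin S) = bigjoin (@aval X Y @` S).
Proof. by []. Qed.

Lemma arrow_lel (X Y : Q) (f : arrow X Y) : aval f <= X.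
Proof. by have := aval_le f; rewrite lexI => /andP[]. Qed.

Lemma arrow_ler (X Y : Q) (f : arrow X Y) : aval f <= Y.
Proof. by have := aval_le f; rewrite lexI => /andP[]. Qed.

Fact ida_le (X : Q) : X <= X `&` X.
Proof. by rewrite meetxx. Qed.

Definition ida (X : Q) : arrow X X := Arrow (ida_le X).

End Arrows.

Section Quantaloid.
Context {d : Order.disp_t} {Q : divQuantaleType d}.
Implicit Types X Y Z W : Q.

Lemma unit_top (a : Q) : a <= 1%g.
Proof.
have [x [_ [xT _]]] := divisibleP _ _ (lex1 (1%g : Q)).
have TT : (\top * \top)%g = \top :> Q.
  apply/eqP; rewrite eq_le lex1 /=.
  by rewrite -{1}(mul1g (\top : Q)); apply: mulq_le2r; exact: lex1.
have : (x * \top * \top)%g = (\top : Q) by rewrite xT mul1g.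
by rewrite -mulgA TT xT => ->; exact: lex1.
Qed.

Lemma mulq_lel (a b : Q) : (a * b)%g <= a.
Proof. by rewrite -{2}(mulg1 a); apply: mulq_le2l; exact: unit_top. Qed.

Lemma mulq_ler (a b : Q) : (a * b)%g <= b.
Proof. by rewrite -{2}(mul1g b); apply: mulq_le2r; exact: unit_top. Qed.

Lemma mulq_lres (a b : Q) : a <= b -> (b * lres b a)%g = a.
Proof.
move=> ab; apply/eqP; rewrite eq_le -lresP lexx /=.
have [_ [y [_ e]]] := divisibleP _ _ ab.
by rewrite {1}e; apply: mulq_le2l; rewrite lresP -e.
Qed.

Lemma rres_mulq (a b : Q) : a <= b -> (rres a b * b)%g = a.
Proof.
move=> ab; apply/eqP; rewrite eq_le -rresP lexx /=.
have [x [_ [e _]]] := divisibleP _ _ ab.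
by rewrite -{1}e; apply: mulq_le2r; rewrite rresP e.
Qed.

Lemma acomp_def X Y Z (g : arrow Y Z) (f : arrow X Y) :
  (aval g * lres Y (aval f) = rres (aval g) Y * aval f)%g.
Proof.
by rewrite -{1}(rres_mulq (arrow_lel g)) -mulgA (mulq_lres (arrow_ler f)).
Qed.

Fact acomp_le X Y Z (g : arrow Y Z) (f : arrow X Y) :
  (aval g * lres Y (aval f))%g <= X `&` Z.
Proof.
rewrite lexI {1}acomp_def (le_trans (mulq_ler _ _) (arrow_lel f)) /=.
exact: le_trans (mulq_lel _ _) (arrow_ler g).
Qed.

(* g ∘ f = g & (Y \ f) = (g / Y) & f, see [acomp_def]. *)
Definition acomp X Y Z (g : arrow Y Z) (f : arrow X Y) : arrow X Z :=
  Arrow (acomp_le g f).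

Local Notation "g ⊚ f" := (acomp g f) (at level 40, left associativity).

Lemma acompA W X Y Z (h : arrow Y Z) (g : arrow X Y) (f : arrow W X) :
  h ⊚ (g ⊚ f) = h ⊚ g ⊚ f.
Proof.
apply: aval_inj; apply: etrans (acomp_def h (g ⊚ f)) _ => /=.
by rewrite mulgA -acomp_def.
Qed.

Lemma acomp1a X Y (f : arrow X Y) : ida Y ⊚ f = f.
Proof. by apply: aval_inj; exact: mulq_lres (arrow_ler f). Qed.

Lemma acompa1 X Y (f : arrow X Y) : f ⊚ ida X = f.
Proof.
apply: aval_inj; apply: etrans (acomp_def f (ida X)) _.
exact: rres_mulq (arrow_lel f).
Qed.

Lemma acomp_joinr X Y Z (g : arrow Y Z) (S : set (arrow X Y)) :
  g ⊚ bigjoin S = bigjoin [set g ⊚ f | f in S].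
Proof.
apply: aval_inj; apply: etrans (acomp_def g (bigjoin S)) _ => /=.
rewrite mulq_joinr !image_comp.
by congr bigjoin; apply: eq_imagel => f _ /=; rewrite acomp_def.
Qed.

Lemma acomp_joinl X Y Z (f : arrow X Y) (S : set (arrow Y Z)) :
  bigjoin S ⊚ f = bigjoin [set g ⊚ f | g in S].
Proof. by apply: aval_inj; rewrite /= mulq_joinl !image_comp. Qed.

Lemma acomp_le2 X Y Z (g g' : arrow Y Z) (f f' : arrow X Y) :
  g <= g' -> f <= f' -> g ⊚ f <= g' ⊚ f'.
Proof.
move=> gg' ff'; apply: (@le_trans _ _ (g' ⊚ f)); rewrite leaE /=.
  exact: mulq_le2r.
by rewrite !acomp_def; apply: mulq_le2l.
Qed.

Lemma arrow_comp_lel X Y Z (g : arrow Y Z) (f : arrow X Y) :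
  aval (g ⊚ f) <= aval g.
Proof. exact: mulq_lel. Qed.

Lemma arrow_comp_ler X Y Z (g : arrow Y Z) (f : arrow X Y) :
  aval (g ⊚ f) <= aval f.
Proof. by rewrite [aval _]acomp_def; exact: mulq_ler. Qed.

Definition alimp X Y Z (h : arrow X Z) (f : arrow X Y) : arrow Y Z :=
  bigjoin [set g | g ⊚ f <= h].
Definition arimp X Y Z (g : arrow Y Z) (h : arrow X Z) : arrow X Y :=
  bigjoin [set f | g ⊚ f <= h].

Lemma alimpP X Y Z (h : arrow X Z) (f : arrow X Y) (g : arrow Y Z) :
  (g <= alimp h f) = (g ⊚ f <= h).
Proof.
apply/idP/idP => [gh|]; last exact: bigjoin_ub.
apply: le_trans (acomp_le2 gh (lexx f)) _; rewrite acomp_joinl.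
by apply: bigjoin_le => _ [k] /= ? <-.
Qed.

Lemma arimpP X Y Z (h : arrow X Z) (f : arrow X Y) (g : arrow Y Z) :
  (f <= arimp g h) = (g ⊚ f <= h).
Proof.
apply/idP/idP => [fh|]; last exact: bigjoin_ub.
apply: le_trans (acomp_le2 (lexx g) fh) _; rewrite acomp_joinr.
by apply: bigjoin_le => _ [k] /= ? <-.
Qed.

End Quantaloid.

Notation "g ⊚ f" := (acomp g f) (at level 40, left associativity).
Notation "h ↙ f" := (alimp h f) (at level 45, no associativity).
Notation "g ↘ h" := (arimp g h) (at level 45, no associativity).

(* Every [arrow X Y] is an element of Q, so hom-arrows whose end types are
   only propositionally equal are compared through [aval], without casts. *)

Section QCategories.
Context {d : Order.disp_t} {Q : divQuantaleType d}.

Record qcat := QCat {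
  qobj :> Type;
  qty : qobj -> Q;
  qhom : forall x y : qobj, arrow (qty x) (qty y);
  qhom_id : forall x, ida (qty x) <= qhom x x;
  qhom_comp : forall x y z, qhom y z ⊚ qhom x y <= qhom x z
}.

Record qfun (A B : qcat) := QFun {
  qmap :> A -> B;
  qmap_ty : forall x, qty (qmap x) = qty x;
  qmap_hom : forall x x', aval (qhom x x') <= aval (qhom (qmap x) (qmap x'))
}.

Definition qle (A : qcat) (x y : A) : Prop :=
  qty x = qty y /\ aval (ida (qty x)) <= aval (qhom x y).

Definition skeletal (A : qcat) : Prop :=
  forall x y : A, qle x y -> qle y x -> x = y.

Definition qfun_id (A : qcat) : qfun A A :=
  @QFun A A id (fun=> erefl) (fun _ _ => lexx _).

Definition qfun_comp (A B C : qcat) (G : qfun B C) (F : qfun A B) : qfun A C :=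
  @QFun A C (fun x => G (F x))
    (fun x => etrans (qmap_ty G (F x)) (qmap_ty F x))
    (fun x x' => le_trans (qmap_hom F x x') (qmap_hom G (F x) (F x'))).

Definition qfun_le (A B : qcat) (F G : qfun A B) : Prop :=
  forall x, qle (F x) (G x).

Definition adjoint (A B : qcat) (F : qfun A B) (G : qfun B A) : Prop :=
  qfun_le (qfun_id A) (qfun_comp G F) /\ qfun_le (qfun_comp F G) (qfun_id B).

Record qdist (A B : qcat) := QDist {
  dmap :> forall (x : A) (y : B), arrow (qty x) (qty y);
  dmap_l : forall x y' y, qhom y' y ⊚ dmap x y' <= dmap x y;
  dmap_r : forall x x' y, dmap x' y ⊚ qhom x x' <= dmap x y
}.

Lemma qfunP (A B : qcat) (F G : qfun A B) : F =1 G -> F = G.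
Proof.
case: F G => [F tF hF] [G tG hG] /= /funext FG; case: G / FG tG hG => tG hG.
by congr QFun; exact: Prop_irrelevance.
Qed.

Definition dist_id (A : qcat) : qdist A A :=
  QDist (fun x y' y => qhom_comp x y' y) (fun x x' y => qhom_comp x x' y).

Section Operations.
Variables A B C : qcat.

Definition dcomp_map (psi : qdist B C) (phi : qdist A B) (x : A) (z : C) :
    arrow (qty x) (qty z) :=
  bigjoin (range (fun y : B => psi y z ⊚ phi x y)).

Fact dcomp_l (psi : qdist B C) (phi : qdist A B) x z' z :
  qhom z' z ⊚ dcomp_map psi phi x z' <= dcomp_map psi phi x z.
Proof.
rewrite acomp_joinr; apply: bigjoin_le => _ [_ [y _ <-] <-].
rewrite acompA; apply: (@le_trans _ _ (psi y z ⊚ phi x y)).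
  exact: acomp_le2 (dmap_l _ _ _ _) _.
by apply: bigjoin_ub; exists y.
Qed.

Fact dcomp_r (psi : qdist B C) (phi : qdist A B) x x' z :
  dcomp_map psi phi x' z ⊚ qhom x x' <= dcomp_map psi phi x z.
Proof.
rewrite acomp_joinl; apply: bigjoin_le => _ [_ [y _ <-] <-].
rewrite -acompA; apply: (@le_trans _ _ (psi y z ⊚ phi x y)).
  exact: acomp_le2 _ (dmap_r _ _ _ _).
by apply: bigjoin_ub; exists y.
Qed.

Definition dcomp (psi : qdist B C) (phi : qdist A B) : qdist A C :=
  QDist (dcomp_l psi phi) (dcomp_r psi phi).

(* The meet is taken in the hom-lattice: over an empty A it is qty y `&` qty z,
   not the top of Q. *)
Definition dlimp_map (eta : qdist A C) (phi : qdist A B) (y : B) (z : C) :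
    arrow (qty y) (qty z) :=
  bigmeet (range (fun x : A => eta x z ↙ phi x y)).

Fact dlimp_l (eta : qdist A C) (phi : qdist A B) y z' z :
  qhom z' z ⊚ dlimp_map eta phi y z' <= dlimp_map eta phi y z.
Proof.
apply: bigmeet_ge => _ [x _ <-]; rewrite alimpP -acompA.
apply: le_trans (dmap_l eta x z' z); apply: acomp_le2 => //.
by rewrite -alimpP; apply: bigmeet_lb; exists x.
Qed.

Fact dlimp_r (eta : qdist A C) (phi : qdist A B) y y' z :
  dlimp_map eta phi y' z ⊚ qhom y y' <= dlimp_map eta phi y z.
Proof.
apply: bigmeet_ge => _ [x _ <-]; rewrite alimpP -acompA.
apply: (@le_trans _ _ (dlimp_map eta phi y' z ⊚ phi x y')).
  exact: acomp_le2 _ (dmap_l _ _ _ _).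
by rewrite -alimpP; apply: bigmeet_lb; exists x.
Qed.

Definition dlimp (eta : qdist A C) (phi : qdist A B) : qdist B C :=
  QDist (dlimp_l eta phi) (dlimp_r eta phi).

Definition drimp_map (psi : qdist B C) (eta : qdist A C) (x : A) (y : B) :
    arrow (qty x) (qty y) :=
  bigmeet (range (fun z : C => psi y z ↘ eta x z)).

Fact drimp_l (psi : qdist B C) (eta : qdist A C) x y' y :
  qhom y' y ⊚ drimp_map psi eta x y' <= drimp_map psi eta x y.
Proof.
apply: bigmeet_ge => _ [z _ <-]; rewrite arimpP acompA.
apply: (@le_trans _ _ (psi y' z ⊚ drimp_map psi eta x y')).
  exact: acomp_le2 (dmap_r _ _ _ _) _.
by rewrite -arimpP; apply: bigmeet_lb; exists z.
Qed.

Fact drimp_r (psi : qdist B C) (eta : qdist A C) x x' y :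
  drimp_map psi eta x' y ⊚ qhom x x' <= drimp_map psi eta x y.
Proof.
apply: bigmeet_ge => _ [z _ <-]; rewrite arimpP acompA.
apply: le_trans (dmap_r eta x x' z); apply: acomp_le2 => //.
by rewrite -arimpP; apply: bigmeet_lb; exists z.
Qed.

Definition drimp (psi : qdist B C) (eta : qdist A C) : qdist A B :=
  QDist (drimp_l psi eta) (drimp_r psi eta).

End Operations.

Lemma dlimp_galois (A B C : qcat) (eta : qdist A C) (phi : qdist A B)
    y z (g : arrow (qty y) (qty z)) :
  g <= dlimp eta phi y z <-> forall x, g ⊚ phi x y <= eta x z.
Proof.
split=> [gl x|gl]; last by apply: bigmeet_ge => _ [x _ <-]; rewrite alimpP.
by rewrite -alimpP; apply: le_trans gl _; apply: bigmeet_lb; exists x.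
Qed.

Lemma drimp_galois (A B C : qcat) (psi : qdist B C) (eta : qdist A C)
    x y (f : arrow (qty x) (qty y)) :
  f <= drimp psi eta x y <-> forall z, psi y z ⊚ f <= eta x z.
Proof.
split=> [fr z|fr]; last by apply: bigmeet_ge => _ [z _ <-]; rewrite arimpP.
by rewrite -arimpP; apply: le_trans fr _; apply: bigmeet_lb; exists z.
Qed.

Lemma dlimp_counit (A B C : qcat) (eta : qdist A C) (phi : qdist A B) x y z :
  dlimp eta phi y z ⊚ phi x y <= eta x z.
Proof. by move: x; apply/dlimp_galois. Qed.

Lemma drimp_counit (A B C : qcat) (psi : qdist B C) (eta : qdist A C) x y z :
  psi y z ⊚ drimp psi eta x y <= eta x z.
Proof. by move: z; apply/drimp_galois. Qed.

Fact star_comp (X : Q) (x y z : unit) : ida X ⊚ ida X <= ida X.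
Proof. by rewrite acomp1a. Qed.

Definition star (X : Q) : qcat :=
  @QCat unit (fun=> X) (fun _ _ => ida X) (fun=> lexx _) (@star_comp X).

Section Full.
Variables (A : qcat) (P : A -> Prop).

Definition qfull : qcat :=
  @QCat {x : A | P x} (fun x => qty (sval x))
    (fun x y => qhom (sval x) (sval y)) (fun x => qhom_id (sval x))
    (fun x y z => qhom_comp (sval x) (sval y) (sval z)).

End Full.

Section Presheaves.
Variable A : qcat.

Record presheaf := Presheaf { pty : Q; pdist :> qdist A (star pty) }.
Record copresheaf := Copresheaf { cty : Q; cdist :> qdist (star cty) A }.

Definition psh_hom (mu la : presheaf) : arrow (pty mu) (pty la) :=
  dlimp la mu tt tt.

Definition cpsh_hom (mu la : copresheaf) : arrow (cty mu) (cty la) :=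
  drimp la mu tt tt.

Fact psh_id (mu : presheaf) : ida (pty mu) <= psh_hom mu mu.
Proof.
by apply/(@dlimp_galois _ _ _ mu mu tt tt) => x; rewrite acomp1a.
Qed.

Fact psh_comp (mu la nu : presheaf) :
  psh_hom la nu ⊚ psh_hom mu la <= psh_hom mu nu.
Proof.
apply/(@dlimp_galois _ _ _ nu mu tt tt) => x; rewrite -acompA.
apply: (@le_trans _ _ (psh_hom la nu ⊚ la x tt)).
  by apply: acomp_le2 => //; exact: (dlimp_counit la mu x tt tt).
exact: (dlimp_counit nu la x tt tt).
Qed.

Fact cpsh_id (mu : copresheaf) : ida (cty mu) <= cpsh_hom mu mu.
Proof.
by apply/(@drimp_galois _ _ _ mu mu tt tt) => x; rewrite acompa1.
Qed.

Fact cpsh_comp (mu la nu : copresheaf) :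
  cpsh_hom la nu ⊚ cpsh_hom mu la <= cpsh_hom mu nu.
Proof.
apply/(@drimp_galois _ _ _ nu mu tt tt) => x; rewrite acompA.
apply: (@le_trans _ _ (la tt x ⊚ cpsh_hom mu la)).
  by apply: acomp_le2 => //; exact: (drimp_counit nu la tt tt x).
exact: (drimp_counit la mu tt tt x).
Qed.

Definition PA : qcat := QCat psh_id psh_comp.
Definition PdA : qcat := QCat cpsh_id cpsh_comp.

(* The copresheaf A(a,-). *)
Definition coyoneda (a : A) : PdA :=
  @Copresheaf (qty a)
    (@QDist (star (qty a)) A (fun _ y => qhom a y)
       (fun _ y' y => qhom_comp a y' y)
       (fun _ _ y => eq_ind_r (fun f => f <= qhom a y) (lexx _)
          (acompa1 (qhom a y)))).

End Presheaves.

Section Isbell.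
Variables (A B : qcat) (phi : qdist A B).

Definition up (mu : PA A) : PdA B := Copresheaf (dlimp phi mu).
Definition down (la : PdA B) : PA A := Presheaf (drimp la phi).

Lemma up_down_adjoint (mu : PA A) (la : PdA B) :
  qhom mu (down la) = qhom (up mu) la.
Proof.
apply/eqP; rewrite eq_le; apply/andP; split.
  apply/(@drimp_galois _ _ _ la (up mu) tt tt) => y.
  apply/(@dlimp_galois _ _ _ phi mu tt y) => x; rewrite -acompA.
  apply: le_trans (drimp_counit la phi x tt y); apply: acomp_le2 => //.
  exact: (dlimp_counit (down la) mu x tt tt).
apply/(@dlimp_galois _ _ _ (down la) mu tt tt) => x.
apply/(@drimp_galois _ _ _ la phi x tt) => y; rewrite acompA.
apply: le_trans (dlimp_counit phi mu x tt y); apply: acomp_le2 => //.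
exact: (drimp_counit la (up mu) tt tt y).
Qed.

End Isbell.

(* A(a,-) = A ↙ mu as copresheaves, so a has the type of mu. *)
Definition qcomplete (A : qcat) : Prop :=
  forall mu : PA A, exists a : A, coyoneda a = up (dist_id A) mu.

Section Cograph.
Variables (A B : qcat) (F : qfun A B).

Fact cograph_le (y : B) (x : A) : aval (qhom y (F x)) <= qty y `&` qty x.
Proof. by rewrite -(qmap_ty F x); exact: aval_le. Qed.

(* B(y, F x), seen in the hom-lattice from qty y to qty x = qty (F x). *)
Definition cograph_map (y : B) (x : A) : arrow (qty y) (qty x) :=
  Arrow (cograph_le y x).

Fact cograph_l y x' x : qhom x' x ⊚ cograph_map y x' <= cograph_map y x.
Proof.
have := qhom_comp y (F x') (F x); rewrite !leaE; apply: le_trans => /=.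
have := qmap_hom F x' x; move: (aval (qhom y (F x'))) (aval _) (aval _) => a b c.
by rewrite (qmap_ty F x'); exact: mulq_le2r.
Qed.

Fact cograph_r y y' x : cograph_map y' x ⊚ qhom y y' <= cograph_map y x.
Proof. exact: (qhom_comp y y' (F x)). Qed.

Definition cograph : qdist B A := QDist cograph_l cograph_r.

Definition pushforward (mu : PA A) : PA B := Presheaf (dcomp mu cograph).

End Cograph.

End QCategories.

Record category := Category {
  cobj :> Type;
  cmor :> cobj -> cobj -> Type;
  cid : forall X, cmor X X;
  ccomp : forall X Y Z, cmor Y Z -> cmor X Y -> cmor X Z;
  ccompA : forall W X Y Z (h : cmor Y Z) (g : cmor X Y) (f : cmor W X),
    ccomp h (ccomp g f) = ccomp (ccomp h g) f;
  ccomp1f : forall X Y (f : cmor X Y), ccomp (cid Y) f = f;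
  ccompf1 : forall X Y (f : cmor X Y), ccomp f (cid X) = f
}.

(* Functors with a prescribed object map: their hom-actions then have
   definitionally known end points and can be specified without casts. *)
Record functor_on (C D : category) (F0 : C -> D) := FunctorOn {
  fmor :> forall X Y : C, cmor X Y -> cmor (F0 X) (F0 Y);
  fmor_id : forall X : C, fmor (cid X) = cid (F0 X);
  fmor_comp : forall (X Y Z : C) (g : cmor Y Z) (f : cmor X Y),
    fmor (ccomp g f) = ccomp (fmor g) (fmor f)
}.

Definition full_subcategory (C : category) (T : Type) (i : T -> C) : category :=
  @Category T (fun X Y => cmor (i X) (i Y)) (fun X => cid (i X))
    (fun X Y Z => @ccomp C (i X) (i Y) (i Z))
    (fun W X Y Z => @ccompA C (i W) (i X) (i Y) (i Z))
    (fun X Y => @ccomp1f C (i X) (i Y)) (fun X Y => @ccompf1 C (i X) (i Y)).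

Definition restriction (C D : category) (T : Type) (i : T -> C) (F0 : C -> D)
    (F : functor_on F0) :
    @functor_on (full_subcategory i) D (fun X => F0 (i X)) :=
  @FunctorOn (full_subcategory i) D (fun X => F0 (i X))
    (fun X Y f => F (i X) (i Y) f) (fun X => fmor_id F (i X))
    (fun X Y Z g f => fmor_comp F g f).

Definition is_iso (C : category) (X Y : C) (f : cmor X Y) : Prop :=
  exists g : cmor Y X, ccomp g f = cid X /\ ccomp f g = cid Y.

Definition natural_iso (C D : category) (F0 G0 : C -> D) (F : functor_on F0)
    (G : functor_on G0) (p : forall X : C, cmor (F0 X) (G0 X)) : Prop :=
  (forall X, is_iso (p X)) /\
  (forall (X Y : C) (f : cmor X Y), ccomp (p Y) (F X Y f) = ccomp (G X Y f) (p X)).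

Section Concepts.
Context {d : Order.disp_t}.
Variable Q : divQuantaleType d.

Record ccat := CCat {
  ccat_qcat :> qcat (Q := Q);
  ccatP : skeletal ccat_qcat /\ qcomplete ccat_qcat
}.

Record ladj (A B : ccat) := LAdj {
  ladj_fun :> qfun A B;
  ladjP : exists G : qfun B A, adjoint ladj_fun G
}.

Lemma ladj_eq (A B : ccat) (F G : ladj A B) : F =1 G -> F = G.
Proof.
case: F G => [F aF] [G aG] /= FG.
have {}FG : F = G by apply: qfunP.
by case: G / FG aG => aG; congr LAdj; exact: Prop_irrelevance.
Qed.

Lemma qle_trans (A : qcat (Q := Q)) (x y z : A) : qle x y -> qle y z -> qle x z.
Proof.
move=> [txy xy] [tyz yz]; split; first by rewrite txy.
have := qhom_comp x y z; rewrite leaE; apply: le_trans => /=.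
by apply: le_trans (mulq_le2r _ yz); rewrite mulq_lres ?arrow_ler.
Qed.

Lemma qfun_qle (A B : qcat (Q := Q)) (F : qfun A B) (x y : A) :
  qle x y -> qle (F x) (F y).
Proof.
move=> [txy xy]; split; first by rewrite !qmap_ty.
by apply: le_trans (qmap_hom F x y); rewrite /= qmap_ty.
Qed.

Fact ladj_id_subproof (A : ccat) :
  exists G : qfun A A, adjoint (qfun_id A) G.
Proof. by exists (qfun_id A); split=> x; split=> //; exact: qhom_id. Qed.

Fact ladj_comp_subproof (A B C : ccat) (G : ladj B C) (F : ladj A B) :
  exists H : qfun C A, adjoint (qfun_comp G F) H.
Proof.
have [G' [uG cG]] := ladjP G; have [F' [uF cF]] := ladjP F.
exists (qfun_comp F' G'); split=> x.
  exact: qle_trans (uF x) (qfun_qle F' (uG (F x))).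
exact: qle_trans (qfun_qle G (cF (G' x))) (cG x).
Qed.

Definition ladj_id (A : ccat) : ladj A A := LAdj (ladj_id_subproof A).

Definition ladj_comp (A B C : ccat) (G : ladj B C) (F : ladj A B) : ladj A C :=
  LAdj (ladj_comp_subproof G F).

Fact ladj_compA (A B C D : ccat) (H : ladj C D) (G : ladj B C) (F : ladj A B) :
  ladj_comp H (ladj_comp G F) = ladj_comp (ladj_comp H G) F.
Proof. exact: ladj_eq. Qed.

Fact ladj_comp1f (A B : ccat) (F : ladj A B) : ladj_comp (ladj_id B) F = F.
Proof. exact: ladj_eq. Qed.

Fact ladj_compf1 (A B : ccat) (F : ladj A B) : ladj_comp F (ladj_id A) = F.
Proof. exact: ladj_eq. Qed.

Definition QCCat : category := Category ladj_compA ladj_comp1f ladj_compf1.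

Record dist_obj := DistObj {
  dsrc : qcat (Q := Q);
  dtgt : qcat (Q := Q);
  ddist :> qdist dsrc dtgt
}.

Record infomorphism (phi psi : dist_obj) := Infomorphism {
  infoF : qfun (dsrc phi) (dsrc psi);
  infoG : qfun (dtgt psi) (dtgt phi);
  infoP : forall x y', aval (phi x (infoG y')) = aval (psi (infoF x) y')
}.

Lemma infomorphism_eq (phi psi : dist_obj) (f g : infomorphism phi psi) :
  infoF f = infoF g -> infoG f = infoG g -> f = g.
Proof.
case: f g => [F G e] [F' G' e'] /= FF GG.
case: F' / FF e' => e'; case: G' / GG e' => e'.
by congr Infomorphism; exact: Prop_irrelevance.
Qed.

Definition info_id (phi : dist_obj) : infomorphism phi phi :=
  @Infomorphism phi phi (qfun_id _) (qfun_id _) (fun _ _ => erefl).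

Definition info_comp (phi psi chi : dist_obj) (g : infomorphism psi chi)
    (f : infomorphism phi psi) : infomorphism phi chi :=
  @Infomorphism phi chi (qfun_comp (infoF g) (infoF f))
    (qfun_comp (infoG f) (infoG g))
    (fun x z => etrans (infoP f x (infoG g z)) (infoP g (infoF f x) z)).

Fact info_compA (phi psi chi xi : dist_obj) (h : infomorphism chi xi)
    (g : infomorphism psi chi) (f : infomorphism phi psi) :
  info_comp h (info_comp g f) = info_comp (info_comp h g) f.
Proof. by apply: infomorphism_eq; exact: qfunP. Qed.

Fact info_comp1f (phi psi : dist_obj) (f : infomorphism phi psi) :
  info_comp (info_id psi) f = f.
Proof. by apply: infomorphism_eq; exact: qfunP. Qed.

Fact info_compf1 (phi psi : dist_obj) (f : infomorphism phi psi) :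
  info_comp f (info_id phi) = f.
Proof. by apply: infomorphism_eq; exact: qfunP. Qed.

Definition QInfo : category := Category info_compA info_comp1f info_compf1.

Definition fixed_cat (phi : dist_obj) : qcat (Q := Q) :=
  qfull (fun mu : PA (dsrc phi) => down phi (up phi mu) = mu).

Record qsubset := QSubset { ss_set :> Type; ss_deg : ss_set -> Q }.

Section Discrete.
Variable A : qsubset.

Definition discr_val (x y : A) : Q := if `[< x = y >] then ss_deg x else \bot.

Fact discr_le (x y : A) : discr_val x y <= ss_deg x `&` ss_deg y.
Proof.
by rewrite /discr_val; case: asboolP => [->|_]; rewrite ?meetxx ?le0x.
Qed.

Definition discr_hom (x y : A) : arrow (ss_deg x) (ss_deg y) :=
  Arrow (discr_le x y).

Fact discr_id (x : A) : ida (ss_deg x) <= discr_hom x x.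
Proof. by rewrite leaE /= /discr_val; case: asboolP. Qed.

Lemma discr_bot (x y : A) : x <> y -> discr_val x y = \bot.
Proof. by rewrite /discr_val; case: asboolP. Qed.

Fact discr_comp (x y z : A) : discr_hom y z ⊚ discr_hom x y <= discr_hom x z.
Proof.
rewrite leaE; have [<-|nyz] := pselect (y = z); first exact: arrow_comp_ler.
have [->|nxy] := pselect (x = y); first exact: arrow_comp_lel.
apply: le_trans (le0x _).
by apply: le_trans (arrow_comp_ler _ _) _; rewrite /= discr_bot.
Qed.

Definition discrete : qcat (Q := Q) := QCat discr_id discr_comp.

End Discrete.

Record context := FuzzyContext {
  ctx_src : qsubset;
  ctx_tgt : qsubset;
  ctx_dist : qdist (discrete ctx_src) (discrete ctx_tgt)
}.

Definition ctx_obj (c : context) : QInfo := DistObj (ctx_dist c).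

Definition QCtx : category := full_subcategory ctx_obj.

Record concept (c : context) := Concept {
  extent : PA (discrete (ctx_src c));
  intent : PdA (discrete (ctx_tgt c));
  intentE : intent = up (ctx_dist c) extent;
  extentE : extent = down (ctx_dist c) intent
}.

Definition concept_lattice (c : context) : qcat (Q := Q) :=
  @QCat d Q (concept c) (fun p => qty (extent p))
    (fun p q => qhom (extent p) (extent q)) (fun p => qhom_id (extent p))
    (fun p q r => qhom_comp (extent p) (extent q) (extent r)).

Lemma concept_type (c : context) (p : concept c) :
  qty (extent p) = qty (intent p).
Proof. by rewrite (intentE p). Qed.

Lemma concept_homE (c : context) (p q : concept c) :
  aval (qhom (extent p) (extent q)) = aval (qhom (intent p) (intent q)).
Proof.
by rewrite (extentE q) (intentE p); congr aval; exact: up_down_adjoint.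
Qed.

End Concepts.

(* Main.v *)
From mathcomp Require Import all_boot all_order.
From mathcomp Require Import boolp.
Require Import Defs.

Set Implicit Arguments.
Unset Strict Implicit.
Unset Printing Implicit Defensive.

Import Order.TTheory.
Local Open Scope order_scope.

(** Proof idea. The closure [down ∘ up] makes the fixed points of [phi] a full
    reflective subcategory of the presheaves, so the reflection of a weighted
    join of presheaves is a supremum among them. For an infomorphism [(F, G)],
    restriction [nu ↦ nu ∘ F_♮] along [F] is right adjoint to pushforward, and
    the identity [phi(x, G y') = psi(F x, y')] shows that it preserves fixed
    points; hence [M(F, G)] is left adjoint to restriction. As restriction is
    strictly functorial, uniqueness of left adjoints into skeletal categories
    makes [M] functorial. *)

(** * Comparing arrows of different types through their values in [Q] *)

Section Arrows.
Context {d : Order.disp_t} {Q : divQuantaleType d}.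
Implicit Types X Y Z : Q.

(** The value [g & (Y \ f)] mentions only the middle type, so the outer types may differ freely. *)
Lemma aval_acomp_le X X' Y Y' Z Z' (g : arrow Y Z) (f : arrow X Y)
    (g' : arrow Y' Z') (f' : arrow X' Y') :
  Y = Y' -> aval g <= aval g' -> aval f <= aval f' ->
  aval (g ⊚ f) <= aval (g' ⊚ f').
Proof.
move=> YY gg ff; case: Y' / YY g' f' gg ff => g' f' gg ff.
apply: (@le_trans _ _ (rres (aval g) Y * aval f')%g).
  by rewrite [X in X <= _]acomp_def; exact: mulq_le2l.
by rewrite -acomp_def; exact: mulq_le2r.
Qed.

Lemma aval_le2 X Y (f g : arrow X Y) : f <= g -> aval f <= aval g.
Proof. by []. Qed.

Lemma arrow_eq_le X Y (f g : arrow X Y) :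
  (forall h : arrow X Y, h <= f <-> h <= g) -> f = g.
Proof. by move=> fg; apply/le_anti/andP; split; apply/fg. Qed.

(** Retypes an arrow along equalities such as [qty (F x) = qty x], so that the Galois lemmas apply
    to it. *)
Lemma arrow_cast X X' Y Y' (a : arrow X Y) :
  X = X' -> Y = Y' -> exists b : arrow X' Y', aval b = aval a.
Proof. by move=> <- <-; exists a. Qed.

End Arrows.

(** * Uniqueness of left adjoints *)

Section Adjoints.
Context {d : Order.disp_t} {Q : divQuantaleType d}.
Implicit Types A B C : qcat (Q := Q).

Lemma qle_refl A (x : A) : qle x x.
Proof. by split=> //; exact: qhom_id. Qed.

Lemma adjoint_comp A B C (F : qfun A B) (F' : qfun B A) (G : qfun B C)
    (G' : qfun C B) :
  adjoint F F' -> adjoint G G' -> adjoint (qfun_comp G F) (qfun_comp F' G').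
Proof.
move=> [uF cF] [uG cG]; split=> x.
  exact: qle_trans (uF x) (qfun_qle F' (uG (F x))).
exact: qle_trans (qfun_qle G (cF (G' x))) (cG x).
Qed.

(** [F x ≤ F (G (F' x)) ≤ F' x], by the unit of [F'] and the counit of [F]. *)
Lemma adjoint_le A B (F F' : qfun A B) (G : qfun B A) :
  adjoint F G -> adjoint F' G -> qfun_le F F'.
Proof.
by move=> [_ c] [u _] x; exact: qle_trans (qfun_qle F (u x)) (c (F' x)).
Qed.

Lemma adjoint_unique A B (F F' : qfun A B) (G : qfun B A) :
  skeletal B -> adjoint F G -> adjoint F' G -> F = F'.
Proof.
move=> skB adF adF'; apply: qfunP => x; apply: skB.
  exact: (adjoint_le adF adF').
exact: (adjoint_le adF' adF).
Qed.

Lemma adjoint_id A : adjoint (qfun_id A) (qfun_id A).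
Proof. by split=> x; exact: qle_refl. Qed.

Lemma adjoint_cancel A B (F : qfun A B) (G : qfun B A) :
  cancel F G -> cancel G F -> adjoint F G.
Proof.
by move=> FK GK; split=> x /=; rewrite ?FK ?GK; exact: qle_refl.
Qed.

End Adjoints.

(** * Equality and order of presheaves *)

Section Presheaves.
Context {d : Order.disp_t} {Q : divQuantaleType d}.
Implicit Types A B : qcat (Q := Q).

Lemma presheaf_eq A (mu la : presheaf A) : pty mu = pty la ->
  (forall x, aval (mu x tt) = aval (la x tt)) -> mu = la.
Proof.
case: mu la => X [m ml mr] [Y [n nl nr]] /= XY.
case: Y / XY n nl nr => n nl nr mn.
have {}mn : m = n.
  apply: functional_extensionality_dep => x.
  by apply: functional_extensionality_dep => -[]; exact: aval_inj.
case: n / mn nl nr => nl nr.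
by congr (Presheaf (QDist _ _)); exact: Prop_irrelevance.
Qed.

Lemma copresheaf_eq A (mu la : copresheaf A) : cty mu = cty la ->
  (forall x, aval (mu tt x) = aval (la tt x)) -> mu = la.
Proof.
case: mu la => X [m ml mr] [Y [n nl nr]] /= XY.
case: Y / XY n nl nr => n nl nr mn.
have {}mn : m = n.
  apply: functional_extensionality_dep => -[].
  by apply: functional_extensionality_dep => x; exact: aval_inj.
case: n / mn nl nr => nl nr.
by congr (Copresheaf (QDist _ _)); exact: Prop_irrelevance.
Qed.

Lemma psh_homP A (mu la : presheaf A) (f : arrow (pty mu) (pty la)) :
  f <= psh_hom mu la <-> forall x, f ⊚ mu x tt <= la x tt.
Proof. exact: (@dlimp_galois _ _ _ _ _ la mu tt tt). Qed.

Lemma psh_qleP A (mu la : PA A) :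
  qle mu la <->
  pty mu = pty la /\ forall x, aval (pdist mu x tt) <= aval (pdist la x tt).
Proof.
case: mu la => X m [Y n]; split=> -[/= XY]; case: Y / XY n => n h; split=> //.
  move=> x.
  have := (@psh_homP _ (Presheaf m) (Presheaf n) (ida X)).1 h x.
  by rewrite acomp1a.
apply/(@psh_homP _ (Presheaf m) (Presheaf n)) => x.
by rewrite acomp1a; exact: h.
Qed.

Lemma PA_skeletal A : skeletal (PA A).
Proof.
move=> mu la /psh_qleP[ty le1] /psh_qleP[_ le2].
by apply: presheaf_eq => // x; apply: le_anti; rewrite le1 le2.
Qed.

End Presheaves.

(** * The closure [down ∘ up] and suprema of its fixed points *)

Section Closure.
Context {d : Order.disp_t} {Q : divQuantaleType d}.
Variables (A B : qcat (Q := Q)) (phi : qdist A B).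
Implicit Types (mu : PA A) (la : PdA B).

(** Transpose of the identity of [up phi mu] under the Isbell adjunction. *)
Lemma down_up_unit mu : ida (qty mu) <= qhom mu (down phi (up phi mu)).
Proof.
by rewrite up_down_adjoint; exact: (@qhom_id _ _ (PdA B) (up phi mu)).
Qed.

Lemma up_down_counit la : ida (qty la) <= qhom (up phi (down phi la)) la.
Proof.
by rewrite -up_down_adjoint; exact: (@qhom_id _ _ (PA A) (down phi la)).
Qed.

Lemma down_hom la la' : qhom la la' <= qhom (down phi la) (down phi la').
Proof.
rewrite up_down_adjoint.
apply: le_trans (qhom_comp (up phi (down phi la)) la la').
rewrite -{1}(acompa1 (qhom la la')).
exact: acomp_le2 (lexx _) (up_down_counit la).
Qed.

(** One inequality precomposes with the unit; the other transposes to the functoriality of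
    [down]. *)
Lemma closure_hom_down mu la :
  qhom (down phi (up phi mu)) (down phi la) = qhom mu (down phi la).
Proof.
apply/le_anti/andP; split; last by rewrite up_down_adjoint; exact: down_hom.
apply: le_trans (qhom_comp mu (down phi (up phi mu)) (down phi la)).
rewrite -{1}(acompa1 (qhom (down phi (up phi mu)) _)).
exact: acomp_le2 (lexx _) (down_up_unit mu).
Qed.

Lemma closure_hom mu nu : down phi (up phi nu) = nu ->
  qhom (down phi (up phi mu)) nu = qhom mu nu.
Proof. by move=> nuE; have := closure_hom_down mu (up phi nu); rewrite nuE. Qed.

Lemma closedP mu : qle (down phi (up phi mu)) mu -> down phi (up phi mu) = mu.
Proof.
by move=> le; apply: PA_skeletal => //; split=> //; exact: down_up_unit.
Qed.

Lemma down_up_down la :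
  down phi (up phi (down phi la)) = down phi la.
Proof.
apply: closedP; split=> //; rewrite closure_hom_down.
exact: (@qhom_id _ _ (PA A) (down phi la)).
Qed.

Section ClosedFamily.
Variables (T : Type) (i : T -> PA A).
Hypothesis i_inj : injective i.
Hypothesis i_closed : forall t, down phi (up phi (i t)) = i t.
Hypothesis i_onto : forall mu, down phi (up phi mu) = mu -> exists t, i t = mu.

(** Fixed points indexed by a bijection [i]. With [i] equal to [sval] or [extent] this is
    convertible to [fixed_cat] or [concept_lattice], so skeletality and completeness are proved once
    for both. *)
Definition family_cat : qcat (Q := Q) :=
  @QCat d Q T (fun t => qty (i t)) (fun s t => qhom (i s) (i t))
    (fun t => qhom_id (i t)) (fun r s t => qhom_comp (i r) (i s) (i t)).

Lemma family_skeletal : skeletal family_cat.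
Proof. by move=> s t st ts; apply: i_inj; exact: PA_skeletal. Qed.

Definition family_dist : qdist A family_cat.
Proof.
exists (fun x (t : family_cat) => pdist (i t) x tt).
- by move=> x s t; move: x; apply/psh_homP.
- by move=> x x' t; exact: (dmap_r (pdist (i t))).
Defined.

(* The supremum of mu is the closure of the join of the presheaves i t
   weighted by mu t, i.e. of mu ∘ family_dist. *)
Lemma family_complete : qcomplete family_cat.
Proof.
move=> mu; pose s := Presheaf (dcomp mu family_dist).
have [t tE] := i_onto (down_up_down (up phi s)).
exists t; apply: copresheaf_eq => [|y]; first by rewrite /= tE.
have hom_tE : aval (qhom (i t) (i y)) = aval (qhom (s : PA A) (i y)).
  by rewrite tE; congr aval; exact: closure_hom (i_closed y).
apply: etrans hom_tE _.
(* Both homs are compared through the arrows [h] below them: either condition unfolds to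
   [h ∘ mu r ∘ i r x ≤ i y x] for all [r] and [x]. *)
congr aval; apply: arrow_eq_le => h.
apply: iff_trans (psh_homP (mu := s) _) _.
apply: iff_trans (iff_sym
  (@dlimp_galois _ _ _ _ _ (dist_id family_cat) mu tt y h)).
split=> [le r|le x].
  apply/(@psh_homP _ _ _ (i r) (i y)) => x; rewrite -acompA.
  apply: le_trans (le x); apply: acomp_le2 => //.
  by apply: bigjoin_ub; exists r.
rewrite acomp_joinr; apply: bigjoin_le => _ [_ [r _ <-] <-].
rewrite acompA; move: x; apply/(@psh_homP _ _ _ (i r) (i y)); exact: le.
Qed.

End ClosedFamily.
End Closure.

(** * Restriction along a functor as right adjoint of pushforward *)

Section Restriction.
Context {d : Order.disp_t} {Q : divQuantaleType d}.
Variables (A B : qcat (Q := Q)) (F : qfun A B).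

Fact restrict_le (nu : PA B) (x : A) :
  aval (pdist nu (F x) tt) <= qty x `&` pty nu.
Proof. by rewrite -(qmap_ty F x); exact: aval_le. Qed.

Definition restrict_map (nu : PA B) (x : A) (u : star (pty nu)) :
  arrow (qty x) (qty u) := Arrow (restrict_le nu x).

Fact restrict_l (nu : PA B) (x : A) (u v : star (pty nu)) :
  qhom u v ⊚ restrict_map x u <= restrict_map x v.
Proof. by rewrite acomp1a. Qed.

Fact restrict_r (nu : PA B) (x x' : A) (u : star (pty nu)) :
  restrict_map x' u ⊚ qhom x x' <= restrict_map x u.
Proof.
rewrite leaE; apply: le_trans (aval_le2 (dmap_r (pdist nu) (F x) (F x') tt)).
by apply: aval_acomp_le; rewrite ?qmap_ty //; exact: qmap_hom.
Qed.

(* Precomposition with F: the presheaf nu ∘ F_♮, computed at x as nu (F x). *)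
Definition restrict (nu : PA B) : PA A :=
  Presheaf (QDist (@restrict_l nu) (@restrict_r nu)).

Lemma restrict_hom (nu nu' : PA B) :
  qhom nu nu' <= qhom (restrict nu) (restrict nu').
Proof.
apply/(@psh_homP _ _ _ (restrict nu) (restrict nu')) => x.
exact: (dlimp_counit nu' nu (F x) tt tt).
Qed.

(** A bound on the pushforward is evaluated at [y = F x], where the join dominates [mu x] because
    [B(F x, F x)] contains the identity. Conversely, the action of [B] on [nu] absorbs the factor
    [B(y, F x)]. *)
Lemma pushforward_hom (mu : PA A) (nu : PA B) :
  qhom (pushforward F mu) nu = qhom mu (restrict nu).
Proof.
apply: arrow_eq_le => h.
apply: iff_trans (@psh_homP _ _ _ (pushforward F mu) nu h) _.
apply: iff_trans _ (iff_sym (@psh_homP _ _ _ mu (restrict nu) h)).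
split=> le.
  move=> x; rewrite leaE; apply: le_trans (aval_le2 (le (F x))).
  apply: aval_acomp_le => //.
  apply: (@le_trans _ _ (aval (pdist mu x tt ⊚ cograph F (F x) x))).
    rewrite -{1}(acompa1 (pdist mu x tt)).
    apply: aval_acomp_le => //; rewrite /= -{1}(qmap_ty F x).
    exact: (qhom_id (F x)).
  by apply: bigjoin_ub; exists (pdist mu x tt ⊚ cograph F (F x) x) => //.
move=> y; rewrite acomp_joinr; apply: bigjoin_le => _ [_ [x _ <-] <-].
rewrite acompA.
apply: le_trans (acomp_le2 (le x) (lexx _)) _.
rewrite leaE; apply: le_trans (aval_le2 (dmap_r (pdist nu) y (F x) tt)).
by apply: aval_acomp_le; rewrite ?qmap_ty.
Qed.

End Restriction.

(** * The adjunction between fixed points induced by an infomorphism *)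

Section Infomorphisms.
Context {d : Order.disp_t} {Q : divQuantaleType d}.
Variables (phi psi : dist_obj Q) (f : infomorphism phi psi).

(** Let [mu] be the restriction of [nu]. The closure of [mu] at [x] is tested only at the points
    [G y'], where [phi(x, G y') = psi(F x, y')]; this bounds it by the closure of [nu] at [F x],
    which is [nu (F x)]. *)
Lemma restrict_closed (nu : PA (dsrc psi)) : down psi (up psi nu) = nu ->
  down phi (up phi (restrict (infoF f) nu)) = restrict (infoF f) nu.
Proof.
move=> nuE; apply: closedP; apply/psh_qleP; split=> // x.
apply: (@le_trans _ _ (aval (drimp (up psi nu) psi (infoF f x) tt))); last first.
  by rewrite -[in X in _ <= X]nuE.
set mu := restrict (infoF f) nu.
have [a aE] := arrow_cast (drimp (up phi mu) phi x tt)
  (esym (qmap_ty (infoF f) x)) (erefl (pty nu)).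
rewrite -[X in X <= _]aE.
apply/(@drimp_galois _ _ _ _ _ (up psi nu) psi) => y'.
rewrite leaE -infoP.
apply: le_trans (aval_le2 (drimp_counit (up phi mu) phi x tt (infoG f y'))).
apply: aval_acomp_le; rewrite ?aE //.
(* It remains that [up psi nu] at [y'] lies below [up phi mu] at [G y']: the meet for [mu] involves
   only the points [F x'], that for [nu] all points. *)
have [b bE] := arrow_cast (dlimp psi nu tt y') (erefl (pty nu))
  (esym (qmap_ty (infoG f) y')).
rewrite -[X in X <= _]bE.
apply/(@dlimp_galois _ _ _ _ _ phi mu tt (infoG f y') b) => x'.
rewrite leaE infoP.
apply: le_trans (aval_le2 (dlimp_counit psi nu (infoF f x') tt y')).
by apply: aval_acomp_le; rewrite ?qmap_ty ?bE.
Qed.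

Definition info_right (nu : fixed_cat psi) : fixed_cat phi :=
  exist _ (restrict (infoF f) (sval nu)) (restrict_closed (svalP nu)).

Definition info_rightF : qfun (fixed_cat psi) (fixed_cat phi) :=
  @QFun _ _ (fixed_cat psi) (fixed_cat phi) info_right (fun=> erefl)
    (fun nu nu' => restrict_hom (infoF f) (sval nu) (sval nu')).

Definition info_left (mu : fixed_cat phi) : fixed_cat psi :=
  exist _ (down psi (up psi (pushforward (infoF f) (sval mu))))
    (down_up_down _ _).

(** The reflection property of the closure, followed by the adjunction of pushforward and
    restriction. Unit, counit and functoriality of [info_left] all follow from this equality. *)
Lemma info_left_hom (mu : fixed_cat phi) (nu : fixed_cat psi) :
  qhom (info_left mu) nu = qhom mu (info_right nu).
Proof.
have := closure_hom (pushforward (infoF f) (sval mu)) (svalP nu).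
by rewrite pushforward_hom; exact: id.
Qed.

Lemma info_left_unit (mu : fixed_cat phi) :
  ida (qty mu) <= qhom mu (info_right (info_left mu)).
Proof. by rewrite -info_left_hom; exact: (qhom_id (info_left mu)). Qed.

Lemma info_left_counit (nu : fixed_cat psi) :
  ida (qty nu) <= qhom (info_left (info_right nu)) nu.
Proof. by rewrite info_left_hom; exact: (qhom_id (info_right nu)). Qed.

Fact info_left_mono (mu mu' : fixed_cat phi) :
  aval (qhom mu mu') <= aval (qhom (info_left mu) (info_left mu')).
Proof.
rewrite -leaE info_left_hom.
apply: le_trans (qhom_comp mu mu' (info_right (info_left mu'))).
rewrite -{1}(acomp1a (qhom mu mu')).
exact: acomp_le2 (info_left_unit mu') (lexx _).
Qed.

Definition info_leftF : qfun (fixed_cat phi) (fixed_cat psi) :=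
  @QFun _ _ (fixed_cat phi) (fixed_cat psi) info_left (fun=> erefl)
    info_left_mono.

Lemma info_adjoint : adjoint info_leftF info_rightF.
Proof.
split=> [mu|nu]; split=> //; first exact: (info_left_unit mu).
exact: (info_left_counit nu).
Qed.

End Infomorphisms.

(** * The functors on infomorphisms and on fuzzy contexts *)

Section ConceptLattices.
Context {d : Order.disp_t} {Q : divQuantaleType d}.

Lemma fixed_cat_eq (phi : QInfo Q) (mu nu : fixed_cat phi) :
  sval mu = sval nu -> mu = nu.
Proof. by case: mu nu => [mu muE] [nu nuE] /= mn; exact: eq_exist. Qed.

Lemma fixed_cat_ccat (phi : QInfo Q) :
  skeletal (fixed_cat phi) /\ qcomplete (fixed_cat phi).
Proof.
split; first exact: (family_skeletal (@fixed_cat_eq phi)).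
apply: (family_complete (phi := phi) (i := fun mu : fixed_cat phi => sval mu)).
  exact: svalP.
move=> mu muE.
by exists (exist (fun nu : PA (dsrc phi) => down phi (up phi nu) = nu) mu muE).
Qed.

Definition closure_mor (phi psi : QInfo Q) (f : infomorphism phi psi) :
    ladj (CCat (fixed_cat_ccat phi)) (CCat (fixed_cat_ccat psi)) :=
  @LAdj _ _ (CCat (fixed_cat_ccat phi)) (CCat (fixed_cat_ccat psi))
    (info_leftF f) (ex_intro _ (info_rightF f) (info_adjoint f)).

Lemma closure_mor_id (phi : QInfo Q) :
  closure_mor (info_id phi) = ladj_id (CCat (fixed_cat_ccat phi)).
Proof.
(* Passing to equality of the underlying functors makes uniqueness of left adjoints applicable. *)
apply: ladj_eq => mu; congr (qmap _ mu).
apply: (adjoint_unique (fixed_cat_ccat phi).1 (info_adjoint _)).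
suff -> : info_rightF (info_id phi) = qfun_id _ by exact: adjoint_id.
by apply: qfunP => nu; apply: fixed_cat_eq; exact: presheaf_eq.
Qed.

Lemma closure_mor_comp (phi psi chi : QInfo Q) (g : infomorphism psi chi)
    (f : infomorphism phi psi) :
  closure_mor (info_comp g f) = ladj_comp (closure_mor g) (closure_mor f).
Proof.
apply: ladj_eq => mu; congr (qmap _ mu).
apply: (adjoint_unique (fixed_cat_ccat chi).1 (info_adjoint _)).
suff -> : info_rightF (info_comp g f) =
    qfun_comp (info_rightF f) (info_rightF g).
  exact: adjoint_comp (info_adjoint f) (info_adjoint g).
by apply: qfunP => nu; apply: fixed_cat_eq; exact: presheaf_eq.
Qed.

Definition closure_functor :
    @functor_on (QInfo Q) (QCCat Q) (fun phi => CCat (fixed_cat_ccat phi)) :=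
  @FunctorOn (QInfo Q) (QCCat Q) (fun phi => CCat (fixed_cat_ccat phi))
    closure_mor closure_mor_id closure_mor_comp.

(** The intent is determined as [up] of the extent. *)
Lemma concept_eq (c : context Q) (x y : concept c) :
  extent x = extent y -> x = y.
Proof.
case: x y => [mu la laE muE] [mu' la' la'E mu'E] /= mm.
case: mu' / mm la'E mu'E => la'E mu'E.
have ll : la = la' by rewrite laE la'E.
case: la' / ll la'E mu'E => la'E mu'E.
by congr Concept; exact: Prop_irrelevance.
Qed.

Lemma extent_closed (c : context Q) (x : concept c) :
  down (ctx_dist c) (up (ctx_dist c) (extent x)) = extent x.
Proof. by rewrite -intentE -extentE. Qed.

Lemma concept_lattice_ccat (c : QCtx Q) :
  skeletal (concept_lattice c) /\ qcomplete (concept_lattice c).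
Proof.
split; first exact: (family_skeletal (@concept_eq c)).
apply: (family_complete (phi := ctx_dist c) (i := @extent _ _ c)).
  exact: extent_closed.
by move=> mu muE; exists (Concept (erefl _) (esym muE)).
Qed.

Definition to_fixed (c : context Q) :
    qfun (concept_lattice c) (fixed_cat (ctx_obj c)) :=
  @QFun _ _ (concept_lattice c) (fixed_cat (ctx_obj c))
    (fun x => exist _ (extent x) (extent_closed x))
    (fun=> erefl) (fun _ _ => lexx _).

Definition of_fixed (c : context Q) :
    qfun (fixed_cat (ctx_obj c)) (concept_lattice c) :=
  @QFun _ _ (fixed_cat (ctx_obj c)) (concept_lattice c)
    (fun mu => @Concept _ _ c (sval mu) _ (erefl _) (esym (svalP mu)))
    (fun=> erefl) (fun _ _ => lexx _).

Lemma to_fixedK (c : context Q) : cancel (to_fixed c) (of_fixed c).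
Proof. by move=> x; exact: concept_eq. Qed.

Lemma of_fixedK (c : context Q) : cancel (of_fixed c) (to_fixed c).
Proof. by move=> mu; exact: fixed_cat_eq. Qed.

Definition extent_mor (c : QCtx Q) :
    ladj (CCat (concept_lattice_ccat c)) (CCat (fixed_cat_ccat (ctx_obj c))) :=
  @LAdj _ _ (CCat (concept_lattice_ccat c))
    (CCat (fixed_cat_ccat (ctx_obj c))) (to_fixed c)
    (ex_intro _ (of_fixed c) (adjoint_cancel (@to_fixedK c) (@of_fixedK c))).

Definition concept_mor (c : QCtx Q) :
    ladj (CCat (fixed_cat_ccat (ctx_obj c))) (CCat (concept_lattice_ccat c)) :=
  @LAdj _ _ (CCat (fixed_cat_ccat (ctx_obj c)))
    (CCat (concept_lattice_ccat c)) (of_fixed c)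
    (ex_intro _ (to_fixed c) (adjoint_cancel (@of_fixedK c) (@to_fixedK c))).

(** Transport of [closure_mor] along the bijection between concepts and fixed points; functoriality
    and naturality then reduce to its cancellation laws. *)
Definition concept_map (c c' : QCtx Q)
    (f : infomorphism (ctx_obj c) (ctx_obj c')) :
    ladj (CCat (concept_lattice_ccat c)) (CCat (concept_lattice_ccat c')) :=
  ladj_comp (concept_mor c') (ladj_comp (closure_mor f) (extent_mor c)).

Lemma concept_map_id (c : QCtx Q) :
  concept_map (info_id (ctx_obj c)) = ladj_id (CCat (concept_lattice_ccat c)).
Proof.
by rewrite /concept_map closure_mor_id; apply: ladj_eq => x; exact: to_fixedK.
Qed.

Lemma concept_map_comp (c c' c'' : QCtx Q)
    (g : infomorphism (ctx_obj c') (ctx_obj c''))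
    (f : infomorphism (ctx_obj c) (ctx_obj c')) :
  concept_map (info_comp g f) = ladj_comp (concept_map g) (concept_map f).
Proof.
rewrite /concept_map closure_mor_comp; apply: ladj_eq => x.
(* The two sides differ by a round trip through the concepts of [c'], inserted between
   [closure_mor f] and [closure_mor g]. *)
apply: (congr1 (fun mu => concept_mor c'' (closure_mor g mu))).
by apply: esym; exact: of_fixedK.
Qed.

Definition concept_functor :
    @functor_on (QCtx Q) (QCCat Q) (fun c => CCat (concept_lattice_ccat c)) :=
  @FunctorOn (QCtx Q) (QCCat Q) (fun c => CCat (concept_lattice_ccat c))
    concept_map concept_map_id concept_map_comp.

Lemma extent_natural_iso :
  natural_iso concept_functor (restriction (@ctx_obj d Q) closure_functor)
    extent_mor.
Proof.
split=> [c|c c' f].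
  exists (concept_mor c); split; apply: ladj_eq; first exact: to_fixedK.
  exact: of_fixedK.
by apply: ladj_eq => x; exact: of_fixedK.
Qed.

End ConceptLattices.

(** The object maps are prescribed except for the proofs [cM] and [cK] that they land in [QCCat];
    these proofs are therefore quantified together with the functors. *)
Theorem proposition7p3p4 (d : Order.disp_t) (Q : divQuantaleType d) :
  exists (cM : forall phi : QInfo Q,
            skeletal (fixed_cat phi) /\ qcomplete (fixed_cat phi))
         (M : @functor_on (QInfo Q) (QCCat Q) (fun phi => CCat (cM phi))),
    (forall (phi psi : QInfo Q) (f : infomorphism phi psi) (mu : fixed_cat phi),
        sval (M phi psi f mu) =
        down psi (up psi (pushforward (infoF f) (sval mu)))) /\
    exists (cK : forall c : QCtx Q,
              skeletal (concept_lattice c) /\ qcomplete (concept_lattice c))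
           (K : @functor_on (QCtx Q) (QCCat Q) (fun c => CCat (cK c)))
           (p : forall c : QCtx Q, ladj (CCat (cK c)) (CCat (cM (ctx_obj c)))),
      (forall (c : QCtx Q) (x : concept c), sval (p c x) = extent x) /\
      natural_iso K (restriction (@ctx_obj d Q) M) p.
Proof.
exists fixed_cat_ccat, closure_functor; split=> //.
exists concept_lattice_ccat, concept_functor, extent_mor.
by split=> //; exact: extent_natural_iso.
Qed.
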